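(* Let $X=\{X(p)\}_{p\in\mathbb{R}^2}$ be a stationary random field on $\mathbb{R}^2$ with correlation function $R_X$ and spectral density $S_X$, where $\widehat{R_X}=S_X$. Let $R_X(p)$ be a radial function, decreasing in $\|p\|$. For a finite energy filter $h_1$ with Fourier transform $H_1$, put $h_2(p):=h_1(p/2)$, $Y_1:=h_1\ast X$, $Y_2:=h_2\ast X$, and let $\sigma_1^2$ and $\sigma_2^2$ be the variances of $Y_1$ and $Y_2$ respectively. If for some $a>0$ the equation $$\sigma_2^2=2^{a+2}\,\sigma_1^2$$ holds for every filter $h_1$ whose Fourier transform $H_1$ belongs to $L^2(\mathbb{R}^2,S_X\,d\omega)$, then $$\int_{\mathbb{R}^2}|R_X(p)|\,dp=\infty .$$
   Context: $\widehat{\ }$ denotes the Fourier transform, so the spectral density $S_X$ is the Fourier transform of the correlation function $R_X$. $L^2(\mathbb{R}^2,S_X\,d\omega)$ is the space of functions $H$ on $\mathbb{R}^2$ with $\int_{\mathbb{R}^2}|H(\omega)|^2S_X(\omega)\,d\omega<\infty$. The value of $a$ is fixed, the same for all filters $h_1$. The filtered fields $Y_1$ and $Y_2$ have spectral densities $S_{Y_1}(\omega)=|H_1(\omega)|^2S_X(\omega)$ and $S_{Y_2}(\omega)=16|H_1(2\omega)|^2S_X(\omega)$, and the variance of each filtered field is the integral of its spectral density over $\mathbb{R}^2$ (up to a common normalization constant depending on the Fourier convention). *)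

(* Defs.v *)
(* MathComp-Analysis, over an arbitrary R : realType. *)
From HB Require Import structures.
From mathcomp Require Import all_boot all_order all_algebra.
From mathcomp Require Import complex.
From mathcomp Require Import all_classical all_reals all_analysis.

Set Implicit Arguments.
Unset Strict Implicit.
Unset Printing Implicit Defensive.

Import Order.TTheory GRing.Theory Num.Theory numFieldNormedType.Exports.

Local Open Scope classical_set_scope.
Local Open Scope ring_scope.

Definition leb2 {R : realType} :
    {measure set (measurableTypeR R * measurableTypeR R) -> \bar R} :=
  (lebesgue_measure \x lebesgue_measure)%E.

(* The library norm on [R * R] is the sup norm; everything below is
   Euclidean. *)
Definition dot {R : realType} (p q : R * R) : R := p.1 * q.1 + p.2 * q.2.

Definition enorm {R : realType} (p : R * R) : R := Num.sqrt (dot p p).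

Definition normsq {R : realType} (z : R[i]) : R :=
  complex.Re z ^+ 2 + complex.Im z ^+ 2.

(* [true] is the first coordinate, [false] the second. *)
Definition slice {R : realType} (b : bool) (f : R * R -> R) (p : R * R)
    (t : R) : R :=
  if b then f (t, p.2) else f (p.1, t).

Definition coord {R : realType} (b : bool) (p : R * R) : R :=
  if b then p.1 else p.2.

Definition partial {R : realType} (b : bool) (f : R * R -> R) :
    R * R -> R :=
  fun p => derive1 (slice b f p) (coord b p).

(* Continuity of the iterated partial derivatives need not be required: as
   all of them are bounded, each of them is Lipschitz. *)
Definition schwartz {R : realType} (f : R * R -> R) : Prop :=
  forall s : seq bool,
    let g := foldr partial f s in
    (forall b p, derivable (slice b g p) (coord b p) 1) /\
    (forall k : nat, exists C : R,
       forall p, (1 + dot p p) ^+ k * `|g p| <= C).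

(* Convention: (f^)(w) = \int f(p) exp (- 2 i pi <p, w>) dp.  With it, the
   variance of a field is the integral of its spectral density, without a
   normalization constant. *)
Definition fourier {R : realType} (f : R * R -> R) (w : R * R) : R[i] :=
  Complex (\int[leb2]_p (f p * cos (2 * pi * dot p w)))
          (- \int[leb2]_p (f p * sin (2 * pi * dot p w))).

(* [f] is a locally integrable function defining a tempered distribution. *)
Definition tempered {R : realType} (f : R * R -> \bar R) : Prop :=
  exists N : nat, leb2.-integrable setT
    (fun p => (f p * ((1 + dot p p) ^- N)%:E)%E).

(* [F] is the Fourier transform of [f] as tempered distributions:
   <f, phi^> = <F, phi> for all test functions (real ones suffice).  For [f]
   integrable or square integrable this is the usual, respectively the
   Plancherel, transform, up to a null set.  Neither [f] nor [F] has to be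
   integrable, and [f] may be infinite on a null set. *)
Definition is_fourier {R : realType} (f : R * R -> \bar R)
    (F : R * R -> R[i]) : Prop :=
  [/\ tempered f,
      tempered (fun w => (complex.Re (F w))%:E),
      tempered (fun w => (complex.Im (F w))%:E) &
      forall phi : R * R -> R, schwartz phi ->
        (\int[leb2]_p (f p * (complex.Re (fourier phi p))%:E) =
         \int[leb2]_w (complex.Re (F w) * phi w)%:E)%E /\
        (\int[leb2]_p (f p * (complex.Im (fourier phi p))%:E) =
         \int[leb2]_w (complex.Im (F w) * phi w)%:E)%E].

(* Wide-sense stationarity, with correlation function
   RX(p) = Cov(X(p + q), X(q)).  Finite variance is not required, RX 0 = +oo
   being allowed: the scale-invariant spectral densities, proportional to
   |w|^(-a), are never integrable. *)
Definition stationary {R : realType} {d : measure_display}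
    {T : measurableType d} (P : probability T R)
    (X : R * R -> {RV P >-> R}) (RX : R * R -> \bar R) : Prop :=
  [/\ forall p, P.-integrable setT (EFin \o X p),
      forall p q, ('E_P[X p] = 'E_P[X q])%E &
      forall p q, covariance P (X (p + q)) (X q) = RX p].

Definition spectral_density {R : realType} (RX : R * R -> \bar R)
    (SX : R * R -> R) : Prop :=
  (forall w, 0 <= SX w) /\ is_fourier RX (fun w => Complex (SX w) 0).

Definition radial {R : realType} (f : R * R -> \bar R) : Prop :=
  forall p q, enorm p = enorm q -> f p = f q.

Definition radially_decreasing {R : realType} (f : R * R -> \bar R) : Prop :=
  forall p q, enorm p <= enorm q -> (f q <= f p)%E.

(* [h] is a (real) finite energy filter with Fourier transform [H], and [H]
   belongs to L^2(R^2, SX dw). *)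
Definition admissible {R : realType} (SX : R * R -> R) (h : R * R -> R)
    (H : R * R -> R[i]) : Prop :=
  [/\ measurable_fun setT h,
      (\int[leb2]_p ((h p) ^+ 2)%:E < +oo)%E,
      is_fourier (EFin \o h) H &
      (\int[leb2]_w (normsq (H w) * SX w)%:E < +oo)%E].

(* [Y] is the operation h |-> h * X.  For a Schwartz filter, h * X is given by
   the convolution integral along almost every path; for a general filter the
   integral may diverge and h * X is the extension by linearity and by the
   isometry Var((h * X)(q)) = \int |H|^2 SX.  The values of [Y] outside of the
   admissible filters are irrelevant. *)
Record filtering {R : realType} {d : measure_display}
    {T : measurableType d} (P : probability T R)
    (X : R * R -> {RV P >-> R}) (SX : R * R -> R)
    (Y : (R * R -> R) -> R * R -> {RV P >-> R}) : Prop := {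
  filtering_convolution : forall h q, schwartz h ->
    {ae P, forall x,
       leb2.-integrable setT (fun p => (h p * X (q - p) x)%:E) /\
       Y h q x = \int[leb2]_p (h p * X (q - p) x)} ;
  filtering_linear : forall (c : R) h H g G q,
    admissible SX h H -> admissible SX g G ->
    {ae P, forall x, Y (fun p => c * h p + g p) q x = c * Y h q x + Y g q x} ;
  filtering_spectral_density : forall h H, admissible SX h H ->
    exists RY : R * R -> \bar R,
      stationary (Y h) RY /\
      spectral_density RY (fun w => normsq (H w) * SX w) ;
  filtering_variance : forall h H q, admissible SX h H ->
    ('V_P[Y h q] = \int[leb2]_w (normsq (H w) * SX w)%:E)%E }.

(* h_2(p) = h_1(p / 2) *)
Definition dilate2 {R : realType} (h : R * R -> R) : R * R -> R :=
  fun p => h (p.1 / 2, p.2 / 2).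

(* Main.v *)
(* Suppose that R_X is integrable.  Being radially decreasing, it is then
   nonnegative.  Testing <R_X, phi^> = <S_X, phi> on the Gaussians
   phi(w) = exp (- t |w|^2) gives
     M(t) := \int exp (- t |w|^2) S_X(w) dw
           = (pi / t) \int R_X(p) exp (- (pi^2 / t) |p|^2) dp,
   so that t M(t) is bounded, by pi \int R_X.  On the other hand, a Gaussian
   filter has a Gaussian transform and its dilation by 2 is again Gaussian, so
   the variance hypothesis on these filters alone reads
   M(4 t) = 2^(a - 2) M(t).  Hence t M(t) is multiplied by 2^a > 1 when t is
   multiplied by 4, and M = 0 since t M(t) is bounded.  Then
   \int R_X(p) exp (- s |p|^2) dp = 0, which forces R_X = 0 away from 0. *)

Require Import Defs.
From HB Require Import structures.
From mathcomp Require Import all_boot all_order all_algebra.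
From mathcomp Require Import complex.
From mathcomp Require Import all_classical all_reals all_analysis.
From mathcomp Require Import measurable_realfun ring lra.

Set Implicit Arguments.
Unset Strict Implicit.
Unset Printing Implicit Defensive.

Import Order.TTheory GRing.Theory Num.Theory numFieldNormedType.Exports.

Local Open Scope classical_set_scope.
Local Open Scope ring_scope.

(** * The Gaussian on the line *)

Definition gauss {R : realType} (s x : R) : R := expR (- (s * x ^+ 2)).
Section gauss.
Context {R : realType}.
Let mu := @lebesgue_measure R.
Implicit Types s x t c : R.

Lemma gauss_gt0 s x : 0 < gauss s x. Proof. exact: expR_gt0. Qed.

Lemma is_derive_continuous (f df : R -> R) : (forall x, is_derive x 1 f (df x)) ->
  continuous f.
Proof.
move=> dF x; apply/differentiable_continuous/derivable1_diffP.
exact: (@ex_derive _ _ _ _ _ _ _ (dF x)).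
Qed.

Lemma is_derive_gauss s x : is_derive x 1 (gauss s) (- (2 * s * x) * gauss s x).
Proof.
pose p : {poly R} := - (s *: 'X^2).
have pE y : p.[y] = - (s * y ^+ 2) by rewrite !hornerE.
have -> : gauss s = expR \o horner p.
  by apply/funext => y /=; rewrite /gauss pE.
apply: is_derive_eq.
rewrite /= mulrC; congr (_ * _); rewrite derivN derivZ derivXn !hornerE/=.
by ring.
Qed.

(** Up to a constant factor, [gauss s] is the centered normal density of variance [(2 * s)^-1],
    whose total mass is 1. *)
Lemma integral_gauss s : 0 < s ->
  mu.-integrable setT (EFin \o gauss s) /\
  \int[mu]_x gauss s x = Num.sqrt (pi / s).
Proof.
move=> s0; pose sg := Num.sqrt (2 * s)^-1.
have sg2 : sg ^+ 2 = (2 * s)^-1 by rewrite sqr_sqrtr// invr_ge0 mulr_ge0// ltW.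
have sg0 : sg != 0 by rewrite sqrtr_eq0 -ltNge invr_gt0 mulr_gt0.
have normE : normal_pdf 0 sg = (fun x => (Num.sqrt (pi / s))^-1 * gauss s x).
  rewrite normal_pdfE//; apply/funext => x; rewrite /normal_peak /normal_fun sg2 subr0.
  congr (_ * _); last congr expR.
  - congr (_ ^-1); congr Num.sqrt; rewrite -mulr_natr; field. by rewrite gt_eqF.
  - rewrite -mulr_natr; field. by rewrite gt_eqF.
have c0 : Num.sqrt (pi / s) != 0 by rewrite sqrtr_eq0 -ltNge divr_gt0// pi_gt0.
have gE : EFin \o gauss s =
    (fun x => (Num.sqrt (pi / s))%:E * (normal_pdf 0 sg x)%:E)%E.
  by apply/funext => x; rewrite normE/= -EFinM mulrA divff// mul1r.
have ig := @integrable_normal_pdf R 0 sg.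
split; first by rewrite gE; apply: integrableZl.
by rewrite /Rintegral -/(comp EFin (gauss s)) gE integralZl// integral_normal_pdf mule1.
Qed.

(** Induction on the polynomial: for [p * 'X + c], the Gaussian splits into two of parameter
    [s / 2]; one controls [p], the other the factor ['X]. *)
Lemma poly_gauss_bounded (p : {poly R}) s : 0 < s ->
  exists C, forall x, `|p.[x]| * gauss s x <= C.
Proof.
have gaussD u v x : gauss (u + v) x = gauss u x * gauss v x.
  by rewrite /gauss -expRD mulrDl opprD.
(* From [1 + u x^2 <= exp (u x^2)]: the product of [1 + u^-1] and [1 + u x^2] contains [1 + x^2],
   which dominates [|x|], and otherwise only nonnegative terms. *)
have lin u : 0 < u -> forall x : R, `|x| * gauss u x <= 1 + u^-1.
  move=> u0 x; rewrite /gauss expRN ler_pdivrMr ?expR_gt0//.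
  apply: (@le_trans _ _ ((1 + u^-1) * (1 + u * x ^+ 2))); last first.
    by rewrite ler_pM2l ?expR_ge1Dx// ltr_wpDr// invr_ge0 ltW.
  have -> : (1 + u^-1) * (1 + u * x ^+ 2) = 1 + x ^+ 2 + (u^-1 + u * x ^+ 2).
    by field; rewrite gt_eqF.
  have : 0 <= u^-1 + u * x ^+ 2.
    apply: addr_ge0; first by rewrite invr_ge0 ltW.
    by rewrite mulr_ge0 ?sqr_ge0// ltW.
  by have := normr_ge0 x; rewrite -(real_normK (num_real x)); nra.
move=> s0; elim/poly_ind: p s s0 => [|p c ih] s s0.
  by exists 0 => x; rewrite horner0 normr0 mul0r.
have s20 : 0 < s / 2 by rewrite divr_gt0.
have [C hC] := ih _ s20.
exists (C * (1 + (s / 2)^-1) + `|c|) => x.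
rewrite !hornerE (le_trans (ler_wpM2r (ltW (gauss_gt0 _ _)) (ler_normD _ _)))//.
rewrite mulrDl lerD//; last first.
  rewrite ler_piMr// -[leRHS]expR0 ler_expR oppr_le0 mulr_ge0 ?sqr_ge0//.
  exact: ltW.
rewrite normrM {1}(splitr s) gaussD mulrACA.
by rewrite ler_pM ?hC ?lin// mulr_ge0// ltW// gauss_gt0.
Qed.

Lemma continuous_gauss s : continuous (gauss s).
Proof. exact: is_derive_continuous (is_derive_gauss s). Qed.

Lemma measurable_gauss s : measurable_fun setT (gauss s).
Proof. by apply: continuous_measurable_fun; exact: continuous_gauss. Qed.

(** Provides the dominating function for differentiating [gausscos] under the integral sign; half of
    the Gaussian absorbs the factor [|x|]. *)
Lemma integrable_id_gauss s : 0 < s ->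
  mu.-integrable setT (fun x => (`|x| * gauss s x)%:E).
Proof.
move=> s0; have s20 : 0 < s / 2 by rewrite divr_gt0.
have [C hC] := poly_gauss_bounded 'X s20.
have [ig _] := integral_gauss s20.
apply: (le_integrable measurableT _ _ (integrableZl measurableT C ig)) => /=.
  apply/measurable_EFinP/measurable_funM; last exact: measurable_gauss.
  exact: normr_measurable.
move=> x _; rewrite lee_fin normrM normr_id normrM.
rewrite ![`|gauss _ _|]gtr0_norm ?gauss_gt0//.
have C0 : 0 <= C by rewrite (le_trans _ (hC 0))// mulr_ge0// ltW// gauss_gt0.
rewrite (ger0_norm C0).
have -> : gauss s x = gauss (s / 2) x * gauss (s / 2) x.
  by rewrite /gauss -expRD; congr expR; field.
by rewrite mulrA ler_wpM2r ?(ltW (gauss_gt0 _ _))//; have := hC x; rewrite hornerX.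
Qed.

(** The fundamental theorem of calculus on the intervals from [- (n + 1)] to [n + 1]: dominated
    convergence gives the integral over the line, and the harmonic bound makes the boundary terms
    vanish. *)
Lemma integral_derive_eq0 (F f : R -> R) (C : R) :
  (forall x, is_derive x 1 F (f x)) -> continuous f ->
  mu.-integrable setT (EFin \o f) ->
  (forall n : nat, `|F n.+1%:R - F (- n.+1%:R)| <= C * harmonic n) ->
  \int[mu]_x f x = 0.
Proof.
move=> dF cf intf FC.
pose D (n : nat) : set R := `[- n.+1%:R, n.+1%:R]%classic.
have ftc n : (\int[mu]_(x in D n) (f x)%:E)%E = (F n.+1%:R - F (- n.+1%:R))%:E.
  rewrite EFinB; apply: continuous_FTC2.
  - by rewrite gtrN.
  - exact: continuous_subspaceT.
  - have cF := is_derive_continuous dF.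
    split.
    + by move=> x _; exact: (@ex_derive _ _ _ _ _ _ _ (dF x)).
    + exact/cvg_at_right_filter/cF.
    + exact/cvg_at_left_filter/cF.
  - by move=> x _; rewrite derive1E; exact: (@derive_val _ _ _ _ _ _ _ (dF x)).
have mf : measurable_fun setT (EFin \o f) by exact: measurable_int intf.
have mD n : measurable (D n) by exact: measurable_itv.
pose f_ n := (EFin \o f) \_ (D n).
have mf_ n : measurable_fun setT (f_ n).
  by apply/(measurable_restrictT _ (mD n)); exact: measurable_funTS.
have f_f : {ae mu, forall x, setT x -> f_ ^~ x @ \oo --> (EFin \o f) x}.
  apply: aeW => x _; apply: cvg_near_cst.
  near=> n; rewrite /f_ patchE mem_set// /D /= in_itv/= -ler_norml.
  rewrite (@le_trans _ _ n%:R)// ?ler_nat//.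
  near: n; exact: nbhs_infty_ger.
have f_le : {ae mu, forall x n, setT x -> (`|f_ n x| <= (abse \o (EFin \o f)) x)%E}.
  apply: aeW => x n _; rewrite /f_ patchE; case: ifP => // _.
  by rewrite abse0 abse_ge0.
have [_ _ ] :=
  @dominated_convergence _ _ _ (@lebesgue_measure R) setT measurableT f_
    (EFin \o f) _ mf_ mf f_f (integrable_abse intf) f_le.
have -> : [sequence (\int[mu]_x f_ n x)%E]_n = fun n => (F n.+1%:R - F (- n.+1%:R))%:E.
  by apply/funext => n; rewrite /= -ftc [RHS]integral_mkcond.
move=> cvI.
have F0 : (fun n => F n.+1%:R - F (- n.+1%:R)) @ \oo --> (0 : R).
  apply: norm_cvg0; apply: (@squeeze_cvgr _ _ _ _ (cst 0) (fun n => C * harmonic n)).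
  - by apply: nearW => n; rewrite normr_ge0/= FC.
  - exact: cvg_cst.
  - rewrite -(mulr0 C); apply: cvgMr; exact: cvg_harmonic.
have {}cvI : (fun n => F n.+1%:R - F (- n.+1%:R)) @ \oo --> \int[mu]_x f x.
  have intE : (\int[mu]_x (EFin \o f) x)%E = (\int[mu]_x f x)%:E.
    by rewrite /Rintegral fineK//; exact: integrable_fin_num.
  by move: cvI; rewrite intE => /fine_cvg.
exact: cvg_unique cvI F0.
Unshelve. all: end_near. Qed.

Lemma is_derive_affine (c t x : R) : is_derive x 1 (fun y => c * y + t) c.
Proof.
have -> : (fun y => c * y + t) = horner (c *: 'X + t%:P).
  by apply/funext => y; rewrite !hornerE.
by apply: is_derive_eq; rewrite derivD derivZ derivX derivC !hornerE.
Qed.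

Lemma is_derive_cosD (c t x : R) :
  is_derive x 1 (fun y => cos (c * y + t)) (- (c * sin (c * x + t))).
Proof.
apply: (is_derive_eq (is_derive1_comp (is_derive_cos _) (is_derive_affine c t x))).
by rewrite mulNr mulrC.
Qed.

Lemma is_derive_sinD (c t x : R) :
  is_derive x 1 (fun y => sin (c * y + t)) (c * cos (c * x + t)).
Proof.
apply: (is_derive_eq (is_derive1_comp (is_derive_sin _) (is_derive_affine c t x))).
by rewrite mulrC.
Qed.

(** The phase [t] treats cosine and sine transforms at once, and absorbs the other coordinate when
    integrating over the plane. [gausssin] is minus the derivative of [gausscos] in [c]. *)
Definition gausscos s t c : R := \int[mu]_x (gauss s x * cos (c * x + t)).
Definition gausssin s t c : R := \int[mu]_x (x * gauss s x * sin (c * x + t)).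

Lemma integrable_gausscos s (t c : R) : 0 < s ->
  mu.-integrable setT (fun x => (gauss s x * cos (c * x + t))%:E).
Proof.
move=> s0; have [ig _] := integral_gauss s0.
apply: (le_integrable measurableT _ _ ig) => /=.
  apply/measurable_EFinP/measurable_funM; first exact: measurable_gauss.
  apply: continuous_measurable_fun.
  exact: (is_derive_continuous (is_derive_cosD c t)).
move=> x _; rewrite lee_fin normrM ler_piMr// ler_norml.
by rewrite cos_geN1 cos_le1.
Qed.

Lemma integrable_gausssin s t c : 0 < s ->
  mu.-integrable setT (fun x => (x * gauss s x * sin (c * x + t))%:E).
Proof.
move=> s0; have ig := integrable_id_gauss s0.
apply: (le_integrable measurableT _ _ ig) => /=.
  apply/measurable_EFinP/measurable_funM.
    by apply: measurable_funM => //; exact: measurable_gauss.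
  apply: continuous_measurable_fun.
  exact: (is_derive_continuous (is_derive_sinD c t)).
move=> x _; rewrite lee_fin !normrM normr_id ler_piMr// ler_norml.
by rewrite sin_geN1 sin_le1.
Qed.

Lemma is_derive_gausscos s (t c : R) : 0 < s ->
  is_derive c 1 (gausscos s t) (- gausssin s t c).
Proof.
move=> s0; pose f c x := gauss s x * cos (c * x + t).
have dfE (x b : R) : is_derive b 1 (f ^~ x) (- (x * gauss s x * sin (b * x + t))).
  have -> : f ^~ x = gauss s x *: (fun y => cos (x * y + t)).
    apply/funext => y.
    rewrite [RHS](_ : _ = gauss s x * cos (x * y + t))//.
    by rewrite /f [y * x]mulrC.
  have h := is_derive_cosD x t b; apply: is_derive_eq.
  by rewrite /GRing.scale/= [b * x]mulrC; ring.
have Ic : `]c - 1, c + 1[%classic c by rewrite /= in_itv/= ltrBlDr ltrDl ltr01.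
have d1 : partial1of2 f = fun b x => - (x * gauss s x * sin (b * x + t)).
  apply/funext => b; apply/funext => x; rewrite partial1of2E.
  exact: (@derive_val _ _ _ _ _ _ _ (dfE x b)).
have intf b : `]c - 1, c + 1[%classic b -> mu.-integrable setT (EFin \o f b).
  by move=> _; exact: integrable_gausscos.
have derf b x : `]c - 1, c + 1[%classic b -> setT x -> derivable (f ^~ x) b 1.
  by move=> _ _; exact: (@ex_derive _ _ _ _ _ _ _ (dfE x b)).
have G0 x : 0 <= `|x| * gauss s x by rewrite mulr_ge0// ltW// gauss_gt0.
have Gub b x : `]c - 1, c + 1[%classic b -> setT x ->
    `|partial1of2 f b x| <= `|x| * gauss s x.
  move=> _ _; rewrite d1 normrN !normrM (gtr0_norm (gauss_gt0 _ _)) ler_piMr//.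
  by rewrite ler_norml sin_geN1 sin_le1.
have iG := integrable_id_gauss s0.
have dC := derivable_under_integral measurableT Ic intf derf G0 iG Gub.
have eC := differentiation_under_integral measurableT Ic intf derf G0 iG Gub.
apply: DeriveDef; first exact: dC.
rewrite -derive1E eC d1 /gausssin -mulN1r -RintegralZl//; last first.
  exact: integrable_gausssin.
by apply: eq_Rintegral => x _; rewrite mulN1r.
Qed.

(** Integration by parts: the derivative of [gauss s x * sin (c * x + t)] has integral zero. *)
Lemma gausssinE s t c : 0 < s -> gausssin s t c = c / (2 * s) * gausscos s t c.
Proof.
move=> s0.
pose F x := gauss s x * sin (c * x + t).
pose f x := - (2 * s) * (x * gauss s x * sin (c * x + t)) +
  c * (gauss s x * cos (c * x + t)).
have dF x : is_derive x 1 F (f x).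
  have h1 := is_derive_gauss s x; have h2 := is_derive_sinD c t x.
  apply: is_derive_eq.
  by rewrite /f /GRing.scale/=; ring.
have i1 := integrableZl measurableT (- (2 * s)) (integrable_gausssin t c s0).
have i2 := integrableZl measurableT c (integrable_gausscos t c s0).
have intf : mu.-integrable setT (EFin \o f) := integrableD measurableT i1 i2.
have cf : continuous f.
  move=> x; apply: cvgD; apply: cvgM.
  - exact: cvg_cst.
  - apply: cvgM; last exact: (is_derive_continuous (is_derive_sinD c t)).
    by apply: cvgM; [exact: cvg_id|exact: continuous_gauss].
  - exact: cvg_cst.
  - apply: cvgM; [exact: continuous_gauss|].
    exact: (is_derive_continuous (is_derive_cosD c t)).
(* Evaluated at [n + 1], this bounds the Gaussian by [C / (n + 1)]; the two endpoints together give
   the constant [2 * C]. *)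
have [C hC] := poly_gauss_bounded (1 + 'X) s0.
have Fb (x : R) (n : nat) : `|x| = n.+1%:R -> `|F x| <= C * harmonic n.
  move=> xn; rewrite /F normrM (gtr0_norm (gauss_gt0 _ _)).
  apply: (@le_trans _ _ (gauss s x)).
    by rewrite ler_piMr ?(ltW (gauss_gt0 _ _))// ler_norml sin_geN1 sin_le1.
  rewrite ler_pdivlMr//; apply: le_trans (hC n.+1%:R).
  rewrite !hornerE ger0_norm ?addr_ge0// mulrC /gauss -(real_normK (num_real x)) xn.
  by rewrite ler_wpM2r ?expR_ge0// lerDr.
have := integral_derive_eq0 (F := F) (f := f) (C := 2 * C) dF cf intf.
have -> : \int[mu]_x f x = - (2 * s) * gausssin s t c + c * gausscos s t c.
  rewrite /f RintegralD// !RintegralZl//;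
    by [exact: integrable_gausscos|exact: integrable_gausssin].
move=> h; suff : - (2 * s) * gausssin s t c + c * gausscos s t c = 0.
  move=> e; have -> : gausssin s t c = c / (2 * s) * gausscos s t c -
      (2 * s)^-1 * (- (2 * s) * gausssin s t c + c * gausscos s t c).
    by field; rewrite gt_eqF.
  by rewrite e mulr0 subr0.
apply: h => n; rewrite (le_trans (ler_normB _ _))//.
by rewrite -mulrA mulr_natl mulr2n lerD// Fb// ?normrN ger0_norm.
Qed.

(* Integrating by parts, [gausscos s t] solves the linear differential equation
   u' = - c / (2 s) u. *)
Lemma gausscosE s t c : 0 < s ->
  gausscos s t c = cos t * Num.sqrt (pi / s) * gauss (4 * s)^-1 c.
Proof.
(* [Z] divides by the expected solution: negating the parameter of a Gaussian gives its reciprocal.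
   The differential equation then makes [Z] constant. *)
move=> s0; pose Z c := gausscos s t c * gauss (- (4 * s)^-1) c.
have Zc : Z c = Z 0.
  apply: is_derive_0_is_cst => x.
  have h1 := is_derive_gausscos t x s0; have h2 := is_derive_gauss (- (4 * s)^-1) x.
  apply: is_derive_eq.
  by rewrite /GRing.scale/= gausssinE//; field; rewrite gt_eqF.
have [_ <-] := integral_gauss s0.
have Z0 : Z 0 = cos t * \int[mu]_x gauss s x.
  rewrite /Z /gauss expr0n mulr0 oppr0 expR0 mulr1 /gausscos.
  under eq_Rintegral do rewrite mul0r add0r mulrC.
  by rewrite RintegralZl//; have [] := integral_gauss s0.
rewrite -Z0 -Zc /Z -mulrA /gauss -expRD.
rewrite [X in expR X](_ : _ = 0) ?expR0 ?mulr1//; ring.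
Qed.
End gauss.

(** * Gaussians on the plane *)

(** Stated for general measures because it serves twice: for the plane as a product of lines, and
    for the product of two planes in [integral_cos_swap]. *)
Lemma integrable_prod {R : realType} d1 d2 (T1 : measurableType d1)
    (T2 : measurableType d2) (m1 : {sigma_finite_measure set T1 -> \bar R})
    (m2 : {sigma_finite_measure set T2 -> \bar R}) (f : T1 -> R) (g : T2 -> R) :
  m1.-integrable setT (EFin \o f) -> m2.-integrable setT (EFin \o g) ->
  (m1 \x m2)%E.-integrable setT (fun p => (f p.1 * g p.2)%:E).
Proof.
move=> intf intg.
have mf : measurable_fun setT f by apply/measurable_EFinP; exact: measurable_int intf.
have mg : measurable_fun setT g by apply/measurable_EFinP; exact: measurable_int intg.
apply/integrable12ltyP.
  apply/measurable_EFinP/measurable_funM.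
    exact: measurableT_comp mf measurable_fst.
  exact: measurableT_comp mg measurable_snd.
have [_ fb] := integrableP _ _ _ intf.
have [_ gb] := integrableP _ _ _ intg.
have -> : (fun x => \int[m2]_y `|(f (x, y).1 * g (x, y).2)%:E|)%E =
   (fun x => `|f x|%:E * (\int[m2]_y `|(g y)%:E|))%E.
  apply/funext => x; rewrite -ge0_integralZl//=.
  - by apply: eq_integral => y _; rewrite normrM EFinM.
  - by apply/measurable_EFinP; exact: measurableT_comp.
rewrite ge0_integralZr//; last exact: integral_ge0.
  rewrite lte_mul_pinfty//; first exact: integral_ge0.
  by rewrite ge0_fin_numE//; exact: integral_ge0.
by apply/measurable_EFinP; exact: measurableT_comp.
Qed.

Section plane.
Context {R : realType}.
Let mu := @lebesgue_measure R.
Implicit Types (p w : R * R) (s t : R).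

Lemma leb2_integralE (f : R * R -> \bar R) : leb2.-integrable setT f ->
  (\int[leb2]_p f p = \int[mu]_x \int[mu]_y f (x, y))%E.
Proof. by move=> intf; rewrite /leb2 -integral12_prod_meas1. Qed.

Lemma leb2_integrable_prod (f g : R -> R) :
  mu.-integrable setT (EFin \o f) -> mu.-integrable setT (EFin \o g) ->
  leb2.-integrable setT (fun p => (f p.1 * g p.2)%:E).
Proof. exact: integrable_prod. Qed.

Definition gauss2 s p : R := expR (- (s * dot p p)).

Lemma gauss2E s p : gauss2 s p = gauss s p.1 * gauss s p.2.
Proof. by rewrite /gauss2 /gauss -expRD /dot; congr expR; ring. Qed.

Lemma gauss2_gt0 s p : 0 < gauss2 s p. Proof. exact: expR_gt0. Qed.

Lemma gauss2_sqr s p : gauss2 s p ^+ 2 = gauss2 (2 * s) p.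
Proof. by rewrite /gauss2 -expRM_natl; congr expR; ring. Qed.

Lemma dot_ge0 p : 0 <= dot p p.
Proof. by rewrite /dot -!expr2 addr_ge0// sqr_ge0. Qed.

Lemma onedot_le p : 1 + dot p p <= (1 + p.1 ^+ 2) * (1 + p.2 ^+ 2).
Proof.
have : 0 <= p.1 ^+ 2 * p.2 ^+ 2 by rewrite mulr_ge0 ?sqr_ge0.
by rewrite /dot !expr2; lra.
Qed.

Lemma measurable_dot (w : R * R) : measurable_fun setT (fun p => dot p w).
Proof.
by rewrite /dot; apply: measurable_funD; apply: measurable_funM.
Qed.
Lemma measurable_dotpp  : measurable_fun setT (fun p : R * R => dot p p).
Proof.
by rewrite /dot; apply: measurable_funD; apply: measurable_funM.
Qed.

Lemma measurable_gauss2 s : measurable_fun setT (gauss2 s).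
Proof.
rewrite (_ : gauss2 s = fun p => gauss s p.1 * gauss s p.2); last first.
  by apply/funext => p; rewrite gauss2E.
apply: measurable_funM; apply: measurableT_comp => //; exact: measurable_gauss.
Qed.

Lemma integrable_gauss2 s : 0 < s -> leb2.-integrable setT (EFin \o gauss2 s).
Proof.
move=> s0; have [ig _] := integral_gauss s0.
have := leb2_integrable_prod ig ig.
by apply: eq_integrable => // p _ /=; rewrite gauss2E.
Qed.

Lemma integrable_gauss2_cos s w t : 0 < s ->
  leb2.-integrable setT (fun p => (gauss2 s p * cos (2 * pi * dot p w + t))%:E).
Proof.
move=> s0; apply: (le_integrable measurableT _ _ (integrable_gauss2 s0)).
  apply/measurable_EFinP/measurable_funM; first exact: measurable_gauss2.
  apply: measurableT_comp.
    by apply: continuous_measurable_fun; exact: continuous_cos.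
  apply: measurable_funD => //; apply: measurable_funM => //; exact: measurable_dot.
move=> p _; rewrite lee_fin normrM ler_piMr// ler_norml.
by rewrite cos_geN1 cos_le1.
Qed.

(** Integrating over [y] first gives a one-dimensional transform with phase [2 * pi * w.1 * x + t];
    integrating over [x] gives a second one. Each contributes a factor [Num.sqrt (pi / s)]. *)
Lemma integral_gauss2_cos s w t : 0 < s ->
  \int[leb2]_p (gauss2 s p * cos (2 * pi * dot p w + t)) =
    cos t * (pi / s) * gauss2 (pi ^+ 2 / s) w.
Proof.
move=> s0; rewrite /Rintegral leb2_integralE; last exact: integrable_gauss2_cos.
pose K u : R := Num.sqrt (pi / s) * gauss (4 * s)^-1 (2 * pi * u).
have Kg u : gauss (4 * s)^-1 (2 * pi * u) = gauss (pi ^+ 2 / s) u.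
  by rewrite /gauss; congr expR; field; rewrite gt_eqF.
have inner x : (\int[mu]_y (gauss2 s (x, y) * cos (2 * pi * dot (x, y) w + t))%:E =
   (K w.2)%:E * (gauss s x * cos (2 * pi * w.1 * x + t))%:E)%E.
  have i1 := integrable_gausscos (2 * pi * w.1 * x + t) (2 * pi * w.2) s0.
  transitivity ((gauss s x)%:E *
      (gausscos s (2 * pi * w.1 * x + t) (2 * pi * w.2))%:E)%E.
    rewrite /gausscos /Rintegral fineK; last exact: integrable_fin_num i1.
    rewrite -integralZl//; apply: eq_integral => y _.
    rewrite -EFinM gauss2E/= mulrA; congr (_ * cos _)%:E.
    by rewrite /dot/=; ring.
  by rewrite gausscosE// /K -!EFinM; congr (_%:E); ring.
under eq_integral do rewrite inner.
have i1 := integrable_gausscos t (2 * pi * w.1) s0.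
rewrite integralZl// fineM//; last exact: integrable_fin_num i1.
rewrite -[X in _ * X]/(gausscos s t (2 * pi * w.1)) gausscosE//= /K !Kg gauss2E.
rewrite [in RHS](_ : pi / s = Num.sqrt (pi / s) * Num.sqrt (pi / s)); last first.
  by rewrite -expr2 sqr_sqrtr// divr_ge0 ?pi_ge0 ?ltW.
by ring.
Qed.

Lemma fourier_gauss2 s : 0 < s -> fourier (gauss2 s) =
  fun w => Complex (pi / s * gauss2 (pi ^+ 2 / s) w) 0.
Proof.
move=> s0; apply/funext => w; rewrite /fourier; congr Complex.
  rewrite -[RHS]mul1r mulrA -[X in X * _ * _]cos0 -integral_gauss2_cos//.
  by apply: eq_Rintegral => p _; rewrite addr0.
(* The sine is the cosine with phase [- (pi / 2)], and the factor [cos (- (pi / 2))] is zero. *)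
rewrite (_ : \int[leb2]_p _ = cos (- (pi / 2)) * (pi / s) * gauss2 (pi ^+ 2 / s) w).
  by rewrite cosN cos_pihalf !mul0r oppr0.
rewrite -integral_gauss2_cos//; apply: eq_Rintegral => p _.
by rewrite cosB cos_pihalf sin_pihalf mulr0 mulr1 add0r.
Qed.
End plane.

(** * Gaussians as Schwartz functions *)

Section schwartz_gauss2.
Context {R : realType}.
Variable s : R.
Hypothesis s_gt0 : 0 < s.
Implicit Types (P Q : {poly R}) (p : R * R).

(** The action of differentiation on the polynomial factor of [P] times [gauss s]. *)
Let deriv_pg P := P^`() - (2 * s) *: ('X * P).

Let is_derive_pg P (x : R) :
  is_derive x 1 (fun t => P.[t] * gauss s t) ((deriv_pg P).[x] * gauss s x).
Proof.
have h := is_derive_gauss s x.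
apply: is_derive_eq.
by rewrite /deriv_pg !hornerE /GRing.scale/=; ring.
Qed.

(** These products form a class that contains [gauss2 s] and is stable under [partial]. *)
Let pg P Q p := (P.[p.1] * gauss s p.1) * (Q.[p.2] * gauss s p.2).

Let is_derive_slice b P Q p : is_derive (Defs.coord b p) 1 (slice b (pg P Q) p)
  (pg (if b then deriv_pg P else P) (if b then Q else deriv_pg Q) p).
Proof.
case: b; rewrite /slice /Defs.coord /pg/=.
  have h := is_derive_pg P p.1.
  have -> : (fun t => P.[t] * gauss s t * (Q.[p.2] * gauss s p.2)) =
            (Q.[p.2] * gauss s p.2) *: (fun t => P.[t] * gauss s t).
    by apply/funext => t; rewrite [LHS]mulrC.
  by apply: is_derive_eq; rewrite /GRing.scale/= mulrC.
have h := is_derive_pg Q p.2.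
have -> : (fun t => P.[p.1] * gauss s p.1 * (Q.[t] * gauss s t)) =
          (P.[p.1] * gauss s p.1) *: (fun t => Q.[t] * gauss s t) by [].
by apply: is_derive_eq.
Qed.

Let foldr_partial_gauss2 l : exists P Q, foldr partial (gauss2 s) l = pg P Q.
Proof.
elim: l => [|b l [P [Q ih]]] /=.
  by exists 1%:P, 1%:P; apply/funext => p; rewrite /pg gauss2E !hornerC !mul1r.
rewrite ih; exists (if b then deriv_pg P else P), (if b then Q else deriv_pg Q).
apply/funext => p; rewrite /partial derive1E.
exact: (@derive_val _ _ _ _ _ _ _ (is_derive_slice b P Q p)).
Qed.

Lemma schwartz_gauss2 : schwartz (gauss2 s).
Proof.
move=> l g; have [P [Q gE]] := foldr_partial_gauss2 l.
rewrite /g gE; split.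
  move=> b p; exact: (@ex_derive _ _ _ _ _ _ _ (is_derive_slice b P Q p)).
move=> k.
(* By [onedot_le] the weight is at most a product of one-variable weights, each of which is absorbed
   into the polynomial of its coordinate. *)
have [C1 h1] := poly_gauss_bounded ((1 + 'X^2) ^+ k * P) s_gt0.
have [C2 h2] := poly_gauss_bounded ((1 + 'X^2) ^+ k * Q) s_gt0.
exists (C1 * C2) => p.
have q0 (x : R) : 0 <= 1 + x ^+ 2 by rewrite addr_ge0// sqr_ge0.
have g0 x : 0 <= gauss s x by rewrite ltW// gauss_gt0.
apply: (@le_trans _ _ ((1 + p.1 ^+ 2) ^+ k * (1 + p.2 ^+ 2) ^+ k * `|pg P Q p|)).
  rewrite ler_wpM2r// -exprMn lerXn2r ?nnegrE ?onedot_le//.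
    by rewrite addr_ge0// dot_ge0.
  by rewrite mulr_ge0.
have -> : (1 + p.1 ^+ 2) ^+ k * (1 + p.2 ^+ 2) ^+ k * `|pg P Q p| =
   (`|((1 + 'X^2) ^+ k * P).[p.1]| * gauss s p.1) *
   (`|((1 + 'X^2) ^+ k * Q).[p.2]| * gauss s p.2).
  have hE P' x : `|((1 + 'X^2) ^+ k * P').[x]| = (1 + x ^+ 2) ^+ k * `|P'.[x]|.
    rewrite hornerM horner_exp hornerD hornerC hornerXn normrM ger0_norm//.
    exact: exprn_ge0.
  by rewrite !hE /pg !normrM !(ger0_norm (g0 _)); ring.
by apply: ler_pM; rewrite ?mulr_ge0 ?h1 ?h2.
Qed.
End schwartz_gauss2.

(** * Test functions and Fubini *)

Section schwartz_theory.
Context {R : realType}.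
Let mu := @lebesgue_measure R.

(** Rounding the first coordinate to a grid gives measurable functions, which converge pointwise to
    [f] by continuity in that coordinate. *)
Lemma measurable_separately_continuous (f : R * R -> R) :
  (forall y, continuous (fun x => f (x, y))) ->
  (forall x, measurable_fun setT (fun y => f (x, y))) ->
  measurable_fun setT f.
Proof.
move=> cf mf.
(* Rounding down to a multiple of [1 / (n + 1)], with an error of at most [1 / (n + 1)]. *)
pose r (n : nat) (x : R) : R := (Num.floor (x * n.+1%:R))%:~R / n.+1%:R.
have rcvg x : r ^~ x @ \oo --> x.
  apply: cvg_zero; apply: norm_cvg0.
  apply: (@squeeze_cvgr _ _ _ _ (cst 0) harmonic).
  - apply: nearW => n; rewrite normr_ge0/=.
    have := real_floor_itv (num_real (x * n.+1%:R)); rewrite intrD => /andP[h1 h2].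
    rewrite /r /= !fctE (_ : _ - x =
      ((Num.floor (x * n.+1%:R))%:~R - x * n.+1%:R) / n.+1%:R); last first.
      by field.
    rewrite normrM [`|_^-1|]ger0_norm ?invr_ge0// ler_piMl// ler_norml.
    by apply/andP; split; lra.
  - exact: cvg_cst.
  - exact: cvg_harmonic.
pose f_ n p := f (r n p.1, p.2).
apply: (@measurable_fun_cvg _ _ _ setT f_).
- move=> n _ B mB; rewrite setTI.
  (* The preimage is a countable union of rectangles, one for each value of the floor, on which the
     first argument of [f] is constant. *)
  rewrite (_ : _ @^-1` _ = \bigcup_(k : int)
    ([set x : R | Num.floor (x * n.+1%:R) = k] `*`
     [set y | B (f (k%:~R / n.+1%:R, y))])); last first.
    apply/seteqP; split => [p Bp|p [k _ /=[<-]]//].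
    by exists (Num.floor (p.1 * n.+1%:R)).
  apply: countable_bigcupT_measurable => [|k]; first exact: countableP.
  apply: measurableX.
    rewrite (_ : [set _ | _] = `[k%:~R / n.+1%:R, (k + 1)%:~R / n.+1%:R[%classic).
      exact: measurable_itv.
    apply/seteqP; split => x /=; rewrite in_itv/= ler_pdivrMr// ltr_pdivlMr//.
      by move=> <-; exact: real_floor_itv (num_real _).
    exact: floor_def.
  have := mf (k%:~R / n.+1%:R) measurableT B mB.
  by rewrite setTI.
- move=> [x y] _.
  exact: (cvg_comp _ _ (rcvg x) (cf y x)).
Qed.

(** Derivability of the slices gives continuity in each variable separately, which is enough for
    measurability. *)
Lemma schwartz_measurable (f : R * R -> R) : schwartz f -> measurable_fun setT f.
Proof.
move=> /(_ [::])[df _]; apply: measurable_separately_continuous => [y|x].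
  move=> x; apply/differentiable_continuous/derivable1_diffP.
  exact: (df true (x, y)).
apply: continuous_measurable_fun => y.
apply/differentiable_continuous/derivable1_diffP.
exact: (df false (x, y)).
Qed.

Lemma integrable_oneDsqrV : mu.-integrable setT (fun x : R => (1 + x ^+ 2)^-1%:E).
Proof.
have m : measurable_fun setT (fun x : R => (1 + x ^+ 2)^-1).
  by apply: continuous_measurable_fun; exact: continuous_oneDsqrV.
apply/integrableP; split; first exact/measurable_EFinP.
under eq_integral do rewrite /= ger0_norm ?invr_ge0 ?addr_ge0 ?sqr_ge0//.
rewrite ge0_symfun_integralT//=.
- rewrite (_ : [set x | _] = `[0, +oo[%classic); last first.
    by apply/seteqP; split => x/=; rewrite in_itv/= andbT.
  by rewrite integral0y_oneDsqr -EFinM ltry.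
- by move=> x; rewrite invr_ge0 addr_ge0// sqr_ge0.
- exact: continuous_oneDsqrV.
- by move=> x/=; rewrite sqrrN.
Qed.

Lemma schwartz_integrable (f : R * R -> R) :
  schwartz f -> leb2.-integrable setT (EFin \o f).
Proof.
move=> sf; have mf := schwartz_measurable sf.
(* The exponent 2 suffices: [(1 + x^2 + y^2)^2] dominates the product of [1 + x^2] and [1 + y^2],
   whose reciprocal is integrable. *)
have [_ /(_ 2) [C hC]] := sf [::].
have i1 := integrable_oneDsqrV.
have i2 := leb2_integrable_prod i1 i1.
apply: (le_integrable measurableT _ _ (integrableZl measurableT C i2)).
  exact/measurable_EFinP.
move=> p _; rewrite lee_fin.
have C0 : 0 <= C.
  rewrite (le_trans _ (hC (0, 0)))// mulr_ge0// exprn_ge0// addr_ge0//.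
  exact: dot_ge0.
have q0 (x : R) : 0 < 1 + x ^+ 2 by rewrite ltr_wpDr// sqr_ge0.
have d1 : 1 <= 1 + dot p p by rewrite lerDl dot_ge0.
apply: le_trans (ler_norm _).
rewrite -invfM ler_pdivlMr ?mulr_gt0//; apply: le_trans (hC p).
rewrite mulrC ler_wpM2r//.
rewrite /dot; have := q0 p.1; have := q0 p.2.
have := sqr_ge0 p.1; have := sqr_ge0 p.2; rewrite !expr2; nra.
Qed.
End schwartz_theory.

(* Within the library, the sigma-finite instance of [m1 \x m2] for sigma-finite
   [m1] and [m2] is shadowed by the one for subprobabilities. *)
Definition leb2_sigma_finite {R : realType} :
    set (measurableTypeR R * measurableTypeR R)%type -> \bar R :=
  (lebesgue_measure \x lebesgue_measure)%E.

Section leb2_sigma_finite.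
Context {R : realType}.

HB.instance Definition _ :=
  Measure.copy (@leb2_sigma_finite R) (lebesgue_measure \x lebesgue_measure)%E.

Let sigma_finite_leb2 : sigma_finite setT (@leb2_sigma_finite R).
Proof.
have /sigma_finiteP[F [TF ndF Foo]] := sigma_finiteT (@lebesgue_measure R).
exists (fun n => F n `*` F n).
  rewrite -setXTT TF predeqE => -[x y]; split.
    move=> [/= [n _ Fnx] [k _ Gky]]; exists (maxn n k) => //; split.
    - by move: x Fnx; exact/subsetPset/ndF/leq_maxl.
    - by move: y Gky; exact/subsetPset/ndF/leq_maxr.
  by move=> [n _ []/= ? ?]; split; exists n.
move=> k; have [? ?] := Foo k; split; first exact: measurableX.
by rewrite /leb2_sigma_finite product_measure1E// lte_mul_pinfty// ge0_fin_numE.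
Qed.

HB.instance Definition _ :=
  Measure_isSigmaFinite.Build _ _ _ (@leb2_sigma_finite R) sigma_finite_leb2.

End leb2_sigma_finite.

(** * Exchange of integrals and the distributional transform of Gaussians *)

Section fourier_pairs.
Context {R : realType}.
Implicit Types (f g : R * R -> R) (s t : R).

Let cosphase t (z : (R * R) * (R * R)) : R := cos (2 * pi * dot z.1 z.2 + t).

Let measurable_cosphase t : measurable_fun setT (cosphase t).
Proof.
apply: measurableT_comp.
  by apply: continuous_measurable_fun; exact: continuous_cos.
apply: measurable_funD => //; apply: measurable_funM => //.
rewrite /dot; apply: measurable_funD; apply: measurable_funM.
- exact: measurableT_comp measurable_fst measurable_fst.
- exact: measurableT_comp measurable_fst measurable_snd.
- exact: measurableT_comp measurable_snd measurable_fst.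
- exact: measurableT_comp measurable_snd measurable_snd.
Qed.

Let dotC (p q : R * R) : dot p q = dot q p.
Proof. by rewrite /dot mulrC [X in _ + X]mulrC. Qed.

Lemma integrable_cosphase t p f : leb2.-integrable setT (EFin \o f) ->
  leb2.-integrable setT (fun w => (f w * cos (2 * pi * dot w p + t))%:E).
Proof.
move=> intf; apply: (le_integrable measurableT _ _ intf).
  apply/measurable_EFinP/measurable_funM.
    by apply/measurable_EFinP; exact: measurable_int intf.
  have := measurableT_comp (measurable_cosphase t) (pair2_measurable p).
  by apply: eq_measurable_fun => w _; rewrite /cosphase/= dotC.
move=> w _; rewrite lee_fin normrM ler_piMr// ler_norml.
by rewrite cos_geN1 cos_le1.
Qed.

(** Fubini for a kernel dominated by [|f p * g w|]. The phases [0] and [pi / 2] give the real and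
    the imaginary part of the Fourier duality. *)
Lemma integral_cos_swap f g t :
  leb2.-integrable setT (EFin \o f) -> leb2.-integrable setT (EFin \o g) ->
  (\int[leb2]_p (f p * \int[leb2]_w (g w * cos (2 * pi * dot w p + t)))%:E =
   \int[leb2]_w ((\int[leb2]_p (f p * cos (2 * pi * dot p w + t))) * g w)%:E)%E.
Proof.
move=> intf intg.
have icos := integrable_cosphase t.
pose K z : \bar R := (f z.1 * g z.2 * cosphase t z)%:E.
have intK : (@leb2_sigma_finite R \x @leb2_sigma_finite R)%E.-integrable setT K.
  have := @integrable_prod R _ _ _ _ (@leb2_sigma_finite R)
    (@leb2_sigma_finite R) _ _ intf intg.
  move=> ifg; apply: (le_integrable measurableT _ _ ifg).
    apply/measurable_EFinP/measurable_funM; last exact: measurable_cosphase.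
    by apply/measurable_EFinP; exact: measurable_int ifg.
  move=> z _; rewrite lee_fin normrM ler_piMr// ler_norml.
  by rewrite cos_geN1 cos_le1.
have := Fubini intK; rewrite /K /=.
have -> : (\int[leb2]_x \int[leb2]_y (f x * g y * cosphase t (x, y))%:E)%E =
    (\int[leb2]_p (f p * \int[leb2]_w (g w * cos (2 * pi * dot w p + t)))%:E)%E.
  apply: eq_integral => p _; rewrite EFinM /Rintegral fineK; last first.
    exact: integrable_fin_num (icos _ _ intg).
  rewrite -integralZl//; last exact: icos.
  by apply: eq_integral => w _; rewrite -EFinM mulrA /cosphase /= dotC.
move=> ->.
apply: eq_integral => w _; rewrite EFinM /Rintegral fineK; last first.
  exact: integrable_fin_num (icos _ _ intf).
rewrite -integralZr//; last exact: icos.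
by apply: eq_integral => p _; rewrite -EFinM mulrAC.
Qed.

Lemma integrable_tempered (f : R * R -> \bar R) :
  leb2.-integrable setT f -> tempered f.
Proof.
move=> intf; exists 0; apply: eq_integrable intf => // p _.
by rewrite expr0 invr1 mule1.
Qed.

Lemma is_fourier_gauss2 s : 0 < s ->
  is_fourier (EFin \o gauss2 s) (fourier (gauss2 s)).
Proof.
move=> s0; have ig := integrable_gauss2 s0.
have u0 : 0 < pi ^+ 2 / s :> R by rewrite divr_gt0// exprn_gt0// pi_gt0.
split.
- exact: integrable_tempered.
- rewrite fourier_gauss2//=; apply: integrable_tempered.
  exact: (integrableZl measurableT (pi / s) (integrable_gauss2 u0)).
- rewrite fourier_gauss2//=; apply: integrable_tempered.
  exact: integrable0.
move=> phi /schwartz_integrable iphi; split.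
  have := integral_cos_swap 0 ig iphi.
  under eq_integral do rewrite EFinM.
  rewrite /fourier/= => h; etransitivity; last etransitivity; [|exact: h|].
    apply: eq_integral => p _; congr (_ * _%:E)%E.
    by apply: eq_Rintegral => w _; rewrite addr0.
  apply: eq_integral => w _; congr (_ * _)%:E.
  by apply: eq_Rintegral => p _; rewrite addr0.
have := integral_cos_swap (pi / 2) ig iphi.
under eq_integral do rewrite EFinM.
(* Since [- sin u = cos (u + pi / 2)], the imaginary part is a phase-shifted cosine integral. *)
have sinE (f : R * R -> R) (w : R * R) : leb2.-integrable setT (EFin \o f) ->
    (- \int[leb2]_p (f p * sin (2 * pi * dot p w)))%R =
    \int[leb2]_p (f p * cos (2 * pi * dot p w + pi / 2)).
  move=> intf; rewrite -mulN1r -RintegralZl//; last first.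
    have := integrable_cosphase (- (pi / 2)) w intf.
    apply: eq_integrable => // p _.
    by rewrite cosB cos_pihalf sin_pihalf mulr0 mulr1 add0r.
  by apply: eq_Rintegral => p _; rewrite cosD cos_pihalf sin_pihalf; ring.
rewrite /fourier/= => h; etransitivity; last etransitivity; [|exact: h|].
  by apply: eq_integral => p _; rewrite sinE.
by apply: eq_integral => w _; rewrite sinE.
Qed.
End fourier_pairs.

(** * Radially decreasing correlation functions *)

Lemma leb2_setX {R : realType} (A B : set (measurableTypeR R)) :
  measurable A -> measurable B ->
  leb2 (A `*` B) = (lebesgue_measure A * lebesgue_measure B)%E.
Proof. exact: product_measure1E. Qed.

Section radially_decreasing_correlation.
Context {R : realType}.
Variable RX : R * R -> \bar R.
Hypotheses (RX_dec : radially_decreasing RX) (mRX : measurable_fun setT RX).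

(** If [RX p] is negative, then [RX] stays at or below it farther out, so [|RX|] is at least a
    positive constant on a set of infinite measure. *)
Lemma radially_decreasing_ge0 : (\int[leb2]_p `|RX p| < +oo)%E ->
  forall p, (0 <= RX p)%E.
Proof.
move=> intRX p; rewrite leNgt; apply/negP => RXp.
(* A half-plane outside the open disc of radius [enorm p], easier to measure than the complement of
   the disc. *)
pose A : set (R * R) := `[enorm p, +oo[%classic `*` setT.
have mA : measurable A by apply: measurableX => //; exact: measurable_itv.
have leA : leb2 A = +oo%E.
  rewrite leb2_setX//= lebesgue_measure_itv/= ltry.
  by rewrite -set_itvNyy lebesgue_measure_itv/= !addye// mulyy.
have RXA q : A q -> (`|RX p| <= `|RX q|)%E.
  move=> [/=]; rewrite in_itv/= andbT => pq _.
  have RXq : (RX q <= RX p)%E.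
    apply: RX_dec; apply: (le_trans pq); apply: (le_trans (ler_norm _)).
    by rewrite -sqrtr_sqr /enorm ler_sqrt ?dot_ge0// /dot -!expr2 lerDl sqr_ge0.
  by rewrite !lte0_abs// ?leeN2// (le_lt_trans RXq).
suff : (+oo <= \int[leb2]_p `|RX p|)%E.
  by rewrite leye_eq => /eqP e; rewrite e ltxx in intRX.
have mabs : measurable_fun setT (fun p => `|RX p|)%E by exact: measurableT_comp.
apply: (@le_trans _ _ (\int[leb2]_(q in A) `|RX p|)%E).
  by rewrite integral_cst// leA gt0_muley// lte0_abs ?oppe_gt0// ltW.
apply: (@le_trans _ _ (\int[leb2]_(q in A) `|RX q|)%E).
  by apply: ge0_le_integral => //; exact: measurable_funTS.
exact: ge0_subset_integral.
Qed.

(** On the disc of radius [enorm p], both [RX] and the Gaussian are at least their values at [p],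
    and [p != 0] gives the disc positive measure. *)
Lemma radially_decreasing_integral_gauss2_gt0 (s : R) p : 0 < s -> 
  (forall q, (0 <= RX q)%E) -> p != 0 -> (0 < RX p)%E ->
  (0 < \int[leb2]_q (RX q * (gauss2 s q)%:E))%E.
Proof.
move=> s0 RX0 p0 RXp.
have dp : 0 < dot p p.
  rewrite lt_neqAle dot_ge0 andbT eq_sym; apply: contra p0.
  rewrite /dot -!expr2 paddr_eq0 ?sqr_ge0// !sqrf_eq0 => /andP[/eqP h1 /eqP h2].
  by apply/eqP; case: p h1 h2 {RXp} => a b /= -> ->.
(* The square of side [r] at the origin lies in the disc: its points satisfy
   [|q|^2 <= 2 r^2 <= |p|^2]. *)
pose r := enorm p / 2.
have r0 : 0 < r by rewrite divr_gt0// sqrtr_gt0.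
pose B : set (R * R) := `[0, r]%classic `*` `[0, r]%classic.
have mB : measurable B by apply: measurableX; exact: measurable_itv.
have leB : leb2 B = (r * r)%:E.
  by rewrite leb2_setX//= lebesgue_measure_itv/= lte_fin r0 oppr0 adde0.
have dB q : B q -> dot q q <= dot p p.
  move=> [/=]; rewrite !in_itv/= => /andP[a0 ar] /andP[b0 br].
  have e : dot p p = 4 * (r * r).
    by rewrite -[LHS]sqr_sqrtr ?dot_ge0// -/(enorm p) /r; field.
  rewrite e /dot.
  have := ler_pM a0 a0 ar ar; have := ler_pM b0 b0 br br.
  have : 0 <= r * r by rewrite mulr_ge0// ltW.
  lra.
have mg : measurable_fun setT (fun q => RX q * (gauss2 s q)%:E)%E.
  apply: emeasurable_funM => //; apply/measurable_EFinP; exact: measurable_gauss2.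
apply: (@lt_le_trans _ _ (\int[leb2]_(q in B) (RX p * (gauss2 s p)%:E))%E).
  by rewrite integral_cst// leB !mule_gt0// lte_fin ?gauss2_gt0// mulr_gt0.
apply: (@le_trans _ _ (\int[leb2]_(q in B) (RX q * (gauss2 s q)%:E))%E).
  apply: ge0_le_integral => //.
  - by move=> q _; rewrite mule_ge0// lee_fin ltW// gauss2_gt0.
  - exact: measurable_funTS.
  - move=> q /dB dqp; apply: lee_pmul => //.
    + by rewrite lee_fin ltW// gauss2_gt0.
    + by apply: RX_dec; rewrite /enorm ler_sqrt ?dot_ge0.
    + by rewrite lee_fin /gauss2 ler_expR lerN2 ler_wpM2l// ltW.
apply: ge0_subset_integral => //.
by move=> q _; rewrite mule_ge0// lee_fin ltW// gauss2_gt0.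
Qed.
End radially_decreasing_correlation.

(** By Bernoulli's inequality the powers of [q] are unbounded, so a positive [m] would exceed [C]
    for an Archimedean choice of [k]. *)
Lemma bounded_geometric_le0 {R : realType} (q m C : R) : 1 < q ->
  (forall k, q ^+ k * m <= C) -> m <= 0.
Proof.
move=> q1 h; rewrite leNgt; apply/negP => m0.
have bern k : 1 + k%:R * (q - 1) <= q ^+ k.
  elim: k => [|k ih]; first by rewrite mul0r addr0.
  rewrite exprS; apply: (@le_trans _ _ (q * (1 + k%:R * (q - 1)))); last first.
    by rewrite ler_pM2l// (lt_trans ltr01).
  have : 0 <= k%:R * (q - 1) ^+ 2 by rewrite mulr_ge0// sqr_ge0.
  by rewrite -natr1 expr2; lra.
have qm0 : 0 < (q - 1) * m by rewrite mulr_gt0// subr_gt0.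
have C0 : 0 <= C by apply: le_trans (h 0); rewrite expr0 mul1r ltW.
have := archi_boundP (divr_ge0 C0 (ltW qm0)).
set k := Num.bound _; rewrite ltr_pdivrMr// => Ck.
have := h k; rewrite leNgt => /negP; apply; apply: (lt_le_trans Ck).
rewrite mulrA ler_pM2r//; apply: le_trans (bern k).
by rewrite lerDr.
Qed.

(** Iterating the scaling from [s] reaches every value [q ^+ k * m s], and all of them are bounded
    by [C]. *)
Lemma bounded_scaling_le0 {R : realType} (m : R -> R) (q r C : R) : 1 < q -> 0 < r ->
  (forall s, 0 < s -> m (s / r) = q * m s) -> (forall s, 0 < s -> m s <= C) ->
  forall s, 0 < s -> m s <= 0.
Proof.
move=> q1 r0 mr mC s s0; apply: (bounded_geometric_le0 (C := C) q1) => k.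
suff [t t0 <-] : exists2 t, 0 < t & m t = q ^+ k * m s by exact: mC.
elim: k => [|k [t t0 ih]]; first by exists s => //; rewrite mul1r.
by exists (t / r); rewrite ?divr_gt0// mr// ih exprS mulrA.
Qed.

(** * Gaussian filters *)

Section gaussian_filters.
Context {R : realType} (RX : R * R -> \bar R) (SX : R * R -> R).
Hypothesis SX_density : spectral_density RX SX.
Implicit Types s t : R.

Let weight (p : R * R) : R := (1 + dot p p).

Let weight_gt0 p : 0 < weight p.
Proof. by rewrite ltr_wpDr// dot_ge0. Qed.

Lemma tempered_measurable (f : R * R -> \bar R) : tempered f -> measurable_fun setT f.
Proof.
move=> [N /(measurable_int) mf].
rewrite (_ : f =
  fun p => (f p * (weight p ^- N)%:E) * (weight p ^+ N)%:E)%E; last first.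
  apply/funext => p; rewrite -muleA -EFinM mulVf ?mule1//.
  by rewrite expf_neq0// gt_eqF.
apply: emeasurable_funM => //; apply/measurable_EFinP.
apply: measurable_funX; apply: measurable_funD => //.
exact: measurable_dotpp.
Qed.

Lemma measurable_correlation : measurable_fun setT RX.
Proof. by have [_ [/tempered_measurable]] := SX_density. Qed.

Lemma measurable_spectral_density : measurable_fun setT SX.
Proof.
have [_ [_ /tempered_measurable mS _ _]] := SX_density.
exact/measurable_EFinP.
Qed.

Hypothesis RX_ge0 : forall p, (0 <= RX p)%E.

(** The formula for [M(t)]: the distributional identity tested on [gauss2 t], whose transform is a
    real Gaussian. *)
Lemma integral_spectral_gauss2 t : 0 < t ->
  (\int[leb2]_w (SX w * gauss2 t w)%:E =
   (pi / t)%:E * \int[leb2]_p (RX p * (gauss2 (pi ^+ 2 / t) p)%:E))%E.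
Proof.
move=> t0; have [_ [_ _ _ /(_ _ (schwartz_gauss2 t0))[+ _]]] := SX_density.
rewrite fourier_gauss2//= => <-.
rewrite -ge0_integralZl//.
- by apply: eq_integral => p _; rewrite EFinM muleCA.
- apply: emeasurable_funM; first exact: measurable_correlation.
  by apply/measurable_EFinP; exact: measurable_gauss2.
- by move=> p _; rewrite mule_ge0// lee_fin ltW// gauss2_gt0.
- by rewrite lee_fin divr_ge0// ?pi_ge0 ?ltW.
Qed.

Lemma integral_correlation_gauss2_le s : 0 <= s ->
  (\int[leb2]_p (RX p * (gauss2 s p)%:E) <= \int[leb2]_p `|RX p|)%E.
Proof.
move=> s0; apply: ge0_le_integral => //.
- by move=> p _; rewrite mule_ge0// lee_fin ltW// gauss2_gt0.
- apply: emeasurable_funM; first exact: measurable_correlation.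
  by apply/measurable_EFinP; exact: measurable_gauss2.
- by apply: measurableT_comp => //; exact: measurable_correlation.
move=> p _; rewrite gee0_abs// -[leRHS]mule1 lee_wpmul2l// lee_fin.
by rewrite -expR0 ler_expR oppr_le0 mulr_ge0// dot_ge0.
Qed.

(** The squared modulus of the transform is a Gaussian with doubled parameter, so the variance is a
    multiple of a value of [M]. *)
Lemma integral_normsq_gauss2 s : 0 < s ->
  (\int[leb2]_w (normsq (fourier (gauss2 s) w) * SX w)%:E =
   ((pi / s) ^+ 2)%:E * \int[leb2]_w (SX w * gauss2 (2 * pi ^+ 2 / s) w)%:E)%E.
Proof.
move=> s0; have [SX0 _] := SX_density.
rewrite -ge0_integralZl//=.
- apply: eq_integral => w _; rewrite fourier_gauss2// /normsq/= expr0n addr0.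
  rewrite -EFinM; congr EFin; rewrite exprMn gauss2_sqr mulrA.
  by ring.
- apply/measurable_EFinP/measurable_funM; last exact: measurable_gauss2.
  exact: measurable_spectral_density.
- by move=> w _; rewrite lee_fin mulr_ge0// ltW// gauss2_gt0.
- by rewrite lee_fin sqr_ge0.
Qed.

Hypothesis RX_integrable : (\int[leb2]_p `|RX p| < +oo)%E.

(** Integrability of [RX] brings the Gaussian filters under the variance hypothesis: their spectral
    integral is a multiple of a Gaussian average of [RX], hence finite. *)
Lemma admissible_gauss2 s : 0 < s ->
  admissible SX (gauss2 s) (fourier (gauss2 s)).
Proof.
move=> s0.
have u0 u : 0 < u -> 0 < pi ^+ 2 / u :> R.
  by move=> u0; rewrite divr_gt0// exprn_gt0// pi_gt0.
split.
- exact: measurable_gauss2.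
- have i2 : leb2.-integrable setT (EFin \o gauss2 (2 * s)).
    by apply: integrable_gauss2; rewrite mulr_gt0.
  have /integrableP[_] := i2; apply: le_lt_trans; rewrite le_eqVlt; apply/orP; left.
  apply/eqP; apply: eq_integral => p _ /=; rewrite ger0_norm ?expR_ge0//.
  by rewrite gauss2_sqr.
- exact: is_fourier_gauss2.
- have t0 : 0 < 2 * (pi ^+ 2 / s) by rewrite mulr_gt0// u0.
  rewrite integral_normsq_gauss2// -(mulrA 2) integral_spectral_gauss2//.
  rewrite lte_mul_pinfty// ?lee_fin ?sqr_ge0//.
  rewrite lte_mul_pinfty// ?lee_fin; first by rewrite divr_ge0 ?pi_ge0 ?ltW.
  apply: le_lt_trans RX_integrable; apply: integral_correlation_gauss2_le.
  exact/ltW/u0.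
Qed.

End gaussian_filters.

Lemma dilate2_gauss2 {R : realType} (s : R) : dilate2 (gauss2 s) = gauss2 (s / 4).
Proof.
by apply/funext => p; rewrite /dilate2 /gauss2 /dot/=; congr expR; field.
Qed.

(** * Scaling of the Gaussian averages of the correlation, and the contradiction *)

Unset Implicit Arguments.

Theorem theorem1 (R : realType) (d : measure_display) (T : measurableType d)
    (P : probability T R) (X : R * R -> {RV P >-> R})
    (RX : R * R -> \bar R) (SX : R * R -> R)
    (Y : (R * R -> R) -> R * R -> {RV P >-> R}) (a : R)
    (X_stationary : stationary X RX)
    (SX_density : spectral_density RX SX)
    (RX_radial : radial RX)
    (RX_decreasing : radially_decreasing RX)
    (RX_nontrivial : exists2 p, p != 0 & RX p != 0%E)
    (Y_filtering : filtering X SX Y)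
    (a_gt0 : 0 < a)
    (variance_scaling : forall (h1 : R * R -> R) (H1 : R * R -> R[i]),
       admissible SX h1 H1 ->
       forall q, ('V_P[Y (dilate2 h1) q] =
                 (2 `^ (a + 2))%:E * 'V_P[Y h1 q])%E) :
  (\int[leb2]_p `|RX p|)%E = +oo%E.
Proof.
apply/eqP; rewrite -leye_eq leNgt; apply/negP => RX_integrable.
have mRX := measurable_correlation SX_density.
have RX_ge0 := radially_decreasing_ge0 RX_decreasing mRX RX_integrable.
(* A nonzero value away from the origin forces positivity on a set of positive measure; a value at
   the origin alone would be invisible to integrals. *)
have [p0 p0_neq0 RXp0_neq0] := RX_nontrivial.
have RXp0 : (0 < RX p0)%E by rewrite lt_neqAle eq_sym RXp0_neq0 RX_ge0.
(* In terms of the header, [t * M t = pi * J (pi ^+ 2 / t)]. *)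
pose J (s : R) := (\int[leb2]_p (RX p * (gauss2 s p)%:E))%E.
have J_le s : 0 <= s -> (J s <= \int[leb2]_p `|RX p|)%E.
  exact: (integral_correlation_gauss2_le SX_density RX_ge0).
have J_gt0 s : 0 < s -> (0 < J s)%E.
  by move=> s0; apply: radially_decreasing_integral_gauss2_gt0 RXp0.
have J_fin s : 0 < s -> J s \is a fin_num.
  move=> s0; rewrite ge0_fin_numE ?ltW ?J_gt0//.
  exact: le_lt_trans (J_le _ (ltW s0)) RX_integrable.
(* With [t = 2 * pi ^+ 2 / s]: the factor [(pi / s) ^+ 2] comes from the squared transform,
   [s / (2 * pi)] is [pi / t], and [s / 2] is [pi ^+ 2 / t]. *)
have varE s : 0 < s -> 'V_P[Y (gauss2 s) 0] =
    ((pi / s) ^+ 2 * (s / (2 * pi)) * fine (J (s / 2)))%:E.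
  move=> s0; have pi0 : 0 < pi :> R := pi_gt0 R.
  have piN0 : pi != 0 :> R by rewrite gt_eqF.
  have sN0 : s != 0 by rewrite gt_eqF.
  have adm := admissible_gauss2 SX_density RX_ge0 RX_integrable s0.
  rewrite (filtering_variance Y_filtering 0 adm) (integral_normsq_gauss2 SX_density)//.
  rewrite (integral_spectral_gauss2 SX_density RX_ge0); last first.
    by rewrite divr_gt0// mulr_gt0// exprn_gt0.
  have e1 (c : R) : c != 0 -> c ^+ 2 / (2 * c ^+ 2 / s) = s / 2.
    by move=> cN0; field; rewrite sN0 cN0.
  have e2 (c : R) : c != 0 -> c / (2 * c ^+ 2 / s) = s / (2 * c).
    by move=> cN0; field; rewrite sN0 cN0.
  rewrite e1// e2//.
  rewrite -/(J (s / 2)) -(fineK (J_fin _ _)) ?divr_gt0//.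
  by rewrite -!EFinM mulrA.
(* The filter is [gauss2 (2 * s)], with dilation [gauss2 (s / 2)]. The variance prefactors are
   [pi / s / 4] before and [pi / s] after dilation, which cancels the 4 in [2^(a + 2) = 4 * 2^a]. *)
have J_scale s : 0 < s -> fine (J (s / 4)) = 2 `^ a * fine (J s).
  move=> s0; have pi0 : 0 < pi :> R := pi_gt0 R.
  have piN0 : pi != 0 :> R by rewrite gt_eqF.
  have sN0 : s != 0 by rewrite gt_eqF.
  have s20 : 0 < 2 * s by rewrite mulr_gt0.
  have adm := admissible_gauss2 SX_density RX_ge0 RX_integrable s20.
  have := variance_scaling _ _ adm 0; have s40 : 0 < s / 4 by rewrite divr_gt0.
  rewrite dilate2_gauss2 !varE// ?divr_gt0// -EFinM => -[].
  rewrite powRD; last by rewrite pnatr_eq0 implybT.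
  have -> : 2 * s / 4 / 2 = s / 4 by field.
  have -> : 2 * s / 2 = s by field.
  have -> : 2 `^ 2 = 4 :> R by rewrite powR_mulrn//; ring.
  move: (pi : R) pi0 piN0 => b b0 bN0 h.
  have e1 : (b / (2 * s / 4)) ^+ 2 * (2 * s / 4 / (2 * b)) = b / s.
    by field; rewrite bN0 sN0.
  have e2 : (b / (2 * s)) ^+ 2 * (2 * s / (2 * b)) = b / s / 4.
    by field; rewrite bN0 sN0.
  have bs0 : b / s != 0 by rewrite mulf_neq0// invr_eq0.
  apply: (mulfI bs0); rewrite -{1}e1 h e2; field; exact: sN0.
have q1 : 1 < 2 `^ a.
  have := gt0_ltr_powR a_gt0 (x := 1) (y := 2).
  by rewrite powR1; apply; rewrite ?nnegrE// ltr1n.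
(* Dividing the argument by 4 multiplies [J] by [2^a > 1], while [J] stays below the integral of
   [|RX|]; hence it cannot be positive. *)
have J1_le0 : fine (J 1) <= 0.
  apply: (bounded_scaling_le0 (m := fine \o J) q1 _ J_scale _ ltr01) => // s s0.
  apply: fine_le; [exact: J_fin| |exact: J_le (ltW s0)].
  by rewrite ge0_fin_numE// integral_ge0.
have := J_gt0 1 ltr01; rewrite -(fineK (J_fin 1 ltr01)) lte_fin.
by rewrite ltNge J1_le0.
Qed.
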